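(* Let $t\in\{0,1,2\}$ and let $\ell\ge 5$ be an integer. Then there exists a connected graph $G$ with a vertex $v\in V(G)$ such that $\gamma_g(G)=\ell$ and $\gamma_g(G)-\gamma_g(G-v)=t$. Likewise, there exists a connected graph $G$ with a vertex $v\in V(G)$ such that $\gamma_g'(G)=\ell$ and $\gamma_g'(G)-\gamma_g'(G-v)=t$.
   Context: Graphs are finite, simple and undirected. A vertex dominates itself and all its neighbors. The domination game on a graph $G$ is played by two players, Dominator and Staller, who alternately choose a vertex of $G$ such that each chosen vertex dominates at least one vertex that was not dominated by the previously chosen vertices. The game ends when all vertices of $G$ are dominated. Dominator wants the total number of chosen vertices to be as small as possible, Staller wants it to be as large as possible. In Game 1 Dominator moves first; in Game 2 Staller moves first. Assuming both play optimally, $\gamma_g(G)$ (the game domination number) is the total number of vertices chosen in Game 1, and $\gamma_g'(G)$ (the Staller-start game domination number) is the total number of vertices chosen in Game 2. $G-v$ denotes the graph obtained from $G$ by removing the vertex $v$ and all edges incident with it. *)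

(* Defs.v *)
From mathcomp Require Import all_boot ssralg ssrint.

Set Implicit Arguments.
Unset Strict Implicit.
Unset Printing Implicit Defensive.

Record sgraph := SGraph {
  vertex :> finType;
  adj : rel vertex;
  adj_sym : symmetric adj;
  adj_irr : irreflexive adj }.

Definition connected (G : sgraph) : Prop :=
  forall x y : G, connect (@adj G) x y.

Section DeleteVertex.
Variables (G : sgraph) (v : G).

Definition del_adj : rel {x : G | x != v} :=
  fun x y => adj (val x) (val y).

Fact del_adj_sym : symmetric del_adj.
Proof. by move=> x y; apply: adj_sym. Qed.

Fact del_adj_irr : irreflexive del_adj.
Proof. by move=> x; apply: adj_irr. Qed.

Definition del_vertex : sgraph := SGraph del_adj_sym del_adj_irr.

End DeleteVertex.

Section DominationGame.
Variable G : sgraph.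
Implicit Types (x : G) (D : {set G}) (n : nat).

Definition cl_neigh x : {set G} := [set y | (y == x) || adj x y].

(* D is the set of vertices dominated by the moves made so far. *)
Definition legal D x : bool := ~~ (cl_neigh x \subset D).

(* Number of moves still to be made under optimal play. Each legal move
   enlarges D, so fuel n >= #|~: D| is never exhausted before the game ends
   (see [game_dominator] and [game_staller]). The default value n' of the
   minimum is harmless: every term is at most n', and a legal move exists as
   long as D is not the whole vertex set. *)
Fixpoint game_rec n (dominator : bool) D : nat :=
  if n is n'.+1 then
    if D == setT then 0
    else if dominator then
      (\big[minn/n']_(x | legal D x) game_rec n' false (D :|: cl_neigh x)).+1
    else (\max_(x | legal D x) game_rec n' true (D :|: cl_neigh x)).+1
  else 0.

Definition game (dominator : bool) D : nat := game_rec #|~: D| dominator D.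

Definition gamma_g : nat := game true set0.

Definition gamma_g' : nat := game false set0.

Lemma game_rec_le n b D : game_rec n b D <= n.
Proof.
elim: n b D => [|n IHn] b D //=; case: eqP => // _; case: b; rewrite ltnS.
  by elim/big_rec: _ => // x k _ le_kn; rewrite geq_min le_kn orbT.
by apply/bigmax_leqP => x _; apply: IHn.
Qed.

Lemma legal_self D x : x \notin D -> legal D x.
Proof.
by move=> xND; apply/subsetPn; exists x => //; rewrite inE eqxx.
Qed.

Lemma legal_exists D : D != setT -> exists x, legal D x.
Proof.
rewrite -subTset => /subsetPn[x _ xND]; exists x; exact: legal_self.
Qed.

Lemma legal_card D x : legal D x -> #|~: (D :|: cl_neigh x)| < #|~: D|.
Proof.
case/subsetPn=> y yx yND; apply/proper_card/properP; split.
  by rewrite setCS subsetUl.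
by exists y; rewrite in_setC ?in_setU ?yx ?orbT.
Qed.

Lemma bigmin_eq_argmin n D (F : G -> nat) x0 :
  legal D x0 -> (forall x, F x <= n) ->
  \big[minn/n]_(x | legal D x) F x = F [arg min_(x < x0 | legal D x) F x].
Proof.
move=> x0L F_le; case: arg_minnP => // y yL y_min; apply/eqP.
rewrite eqn_leq; apply/andP; split.
  have: y \in index_enum G by rewrite mem_index_enum.
  elim: (index_enum G) => // z r IHr; rewrite big_cons inE.
  case/orP=> [/eqP <-|/IHr le_y]; first by rewrite yL geq_minl.
  by case: ifP => // _; rewrite geq_min le_y orbT.
by elim/big_rec: _ => // x k xL le_k; rewrite leq_min y_min.
Qed.

Lemma game_rec_fuel n b D : #|~: D| <= n -> game_rec n b D = game b D.
Proof.
rewrite /game; move: {2}#|~: D| (leqnn #|~: D|) => m.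
elim: m n b D => [|m IHm] n b D.
  rewrite leqn0 cards_eq0 => /eqP D0 _.
  have ->: D = setT by rewrite -[D]setCK D0 setC0.
  by rewrite setCT cards0; case: n => //= n; rewrite eqxx.
case En: #|~: D| => [|k] le_m le_n.
  by apply: etrans (IHm n b D _ _) _; rewrite ?En.
case: n le_n => // n; rewrite !ltnS in le_m * => le_n /=.
case: eqP => // /eqP /legal_exists[x0 x0L].
have IH (c : bool) x : legal D x ->
  game_rec n c (D :|: cl_neigh x) = game_rec k c (D :|: cl_neigh x).
  move=> /legal_card; rewrite En ltnS => le_k.
  by rewrite !IHm // ?(leq_trans le_k).
case: b; last by rewrite (eq_bigr _ (IH true)).
rewrite !(@bigmin_eq_argmin _ _ _ x0) //; try by move=> x; apply: game_rec_le.
case: arg_minnP => // y yL y_min; case: arg_minnP => // z zL z_min.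
congr _.+1; apply/eqP; rewrite eqn_leq.
by rewrite -[X in _ <= X]IH // y_min // [X in _ <= X]IH // z_min.
Qed.

Lemma game_end b : game b setT = 0.
Proof. by rewrite /game setCT cards0. Qed.

Lemma game_dominator D : D != setT ->
  (exists2 x, legal D x & game true D = (game false (D :|: cl_neigh x)).+1) /\
  (forall x, legal D x -> game true D <= (game false (D :|: cl_neigh x)).+1).
Proof.
move=> DT; have [x0 x0L] := legal_exists DT.
have [n En] : exists n, #|~: D| = n.+1.
  by exists #|~: D|.-1; rewrite prednK // (leq_ltn_trans _ (legal_card x0L)).
have E x : legal D x ->
    game_rec n false (D :|: cl_neigh x) = game false (D :|: cl_neigh x).
  by move/legal_card; rewrite En ltnS; apply: game_rec_fuel.
have -> : game true D =
    (\big[minn/n]_(x | legal D x) game_rec n false (D :|: cl_neigh x)).+1.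
  by rewrite {1}/game En /= (negPf DT).
rewrite (bigmin_eq_argmin x0L) => [|x]; last exact: game_rec_le.
case: arg_minnP => // y yL y_min; split; first by exists y; rewrite ?E.
by move=> x xL; rewrite ltnS -[X in _ <= X]E // y_min.
Qed.

Lemma game_staller D : D != setT ->
  (exists2 x, legal D x & game false D = (game true (D :|: cl_neigh x)).+1) /\
  (forall x, legal D x -> (game true (D :|: cl_neigh x)).+1 <= game false D).
Proof.
move=> DT; have [x0 x0L] := legal_exists DT.
have [n En] : exists n, #|~: D| = n.+1.
  by exists #|~: D|.-1; rewrite prednK // (leq_ltn_trans _ (legal_card x0L)).
have E x : legal D x ->
    game_rec n true (D :|: cl_neigh x) = game true (D :|: cl_neigh x).
  by move/legal_card; rewrite En ltnS; apply: game_rec_fuel.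
have -> : game false D =
    (\max_(x | legal D x) game true (D :|: cl_neigh x)).+1.
  by rewrite {1}/game En /= (negPf DT) (eq_bigr _ E).
split=> [|x xL]; last by rewrite ltnS (bigmax_sup x).
rewrite (bigmax_eq_arg x0) //.
by case: arg_maxnP => // y yL _; exists y.
Qed.

End DominationGame.

(* Main.v *)
Require Import Defs.
From mathcomp Require Import all_boot ssralg ssrint.

(** The graphs consist of a small core with a distinguished vertex 0 and of q
    pairs (hub, leaf): the hubs form a clique and are all adjacent to vertex 0,
    and each leaf is pendant at its hub.  A move dominates at most one leaf, so
    a game lasts for the number of undominated leaves plus the number of moves
    that dominate no new leaf.  The optimal value of the latter depends only on
    the dominated part of the core and on three bits: whether some hub is
    undominated, whether some leaf is undominated below a dominated hub, and
    whether some leaf is dominated.  In terms of these data a move may have two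
    outcomes, according to how many pairs of each kind are left; a finite table
    that satisfies the optimality equations for every outcome gives the length
    of the game for all q at once.  Deleting a core vertex v amounts to declaring
    it dominated and unplayable.  *)

Set Implicit Arguments.
Unset Strict Implicit.
Unset Printing Implicit Defensive.

(** * Optimality equations for the game length *)

Definition prefers (dominator : bool) m k := if dominator then m <= k else k <= m.

(** Induction on the number of undominated vertices, which every legal move decreases. For each
    player one hypothesis on [F] bounds all moves and the other provides a move attaining the
    bound. *)
Lemma game_unique (G : sgraph) (inv : {set G} -> Prop) (F : bool -> {set G} -> nat) :
  (forall D x, inv D -> inv (D :|: cl_neigh x)) ->
  (forall b, F b setT = 0) ->
  (forall b D x, inv D -> legal D x ->
     prefers b (F b D) (F (~~ b) (D :|: cl_neigh x)).+1) ->
  (forall b D, inv D -> D != setT ->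
     exists2 x, legal D x & prefers b (F (~~ b) (D :|: cl_neigh x)).+1 (F b D)) ->
  forall b D, inv D -> game b D = F b D.
Proof.
move=> invU FT Fall Fex b D.
have [m] := ubnP #|~: D|; elim: m => // m IH in b D *; rewrite ltnS => le_m invD.
have [->|DT] := eqVneq D setT; first by rewrite game_end FT.
have IH' c x : legal D x -> game c (D :|: cl_neigh x) = F c (D :|: cl_neigh x).
  by move=> /legal_card lt; apply: IH (invU _ _ invD); apply: leq_trans lt le_m.
have [x xL xF] := Fex b D invD DT.
have [[z zL gz] minD] := game_dominator DT; have [[t tL gt] maxS] := game_staller DT.
case: b xF => /= xF; apply/eqP; rewrite eqn_leq.
- rewrite (leq_trans (minD x xL)) ?IH' //= gz IH' //.
  exact: (Fall true D z).
- rewrite (leq_trans xF) -?IH' ?maxS // andbT gt IH' //.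
  exact: (Fall false D t).
Qed.

(** * Abstract states, their moves and tables of values *)

(* (some hub is undominated, some leaf is undominated below a dominated hub,
   some leaf is dominated, dominated core vertices) *)
Definition state := (bool * bool * bool * bitseq)%type.

Definition merge_bits (w m : bitseq) := [seq u.1 || u.2 | u <- zip w m].
(* Core vertex 0 is the only one adjacent to the hubs. *)
Definition play_hub (w : bitseq) := if w is _ :: w' then true :: w' else [::].

(** Here [c] tells whether a pair of the other kind than the one played has an undominated leaf;
    that leaf stays undominated. If there is none, further pairs of the played kind decide. *)
Definition hub_outcomes c w : seq state :=
  (false, c, true, play_hub w) ::
  if c then [::] else [:: (false, true, true, play_hub w)].

(* Each move comes with its cost, which is 0 if it dominates a new leaf and 1
   otherwise, and with its possible outcomes.  An option [(b, m)] in [opts] is a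
   core move that dominates the core vertices [m], and the hubs if [b].  The
   outcome listed first is the one for a position with at most one undominated
   hub and at most one undominated leaf below a dominated hub. *)
Definition moves (opts : seq (bool * bitseq)) (s : state) : seq (nat * seq state) :=
  let: (a, b, d, w) := s in
  let w0 := play_hub w in
  flatten
  [:: [seq (1, [:: if m.1 then (false, a || b, d, merge_bits w m.2)
                   else (a, b, d, merge_bits w m.2)])
       | m <- opts & (merge_bits w m.2 != w) || m.1 && a];
      if a then [:: (0, hub_outcomes b w);
                    (0, [:: (false, b, true, w); (true, b, true, w)])] else [::];
      if b then [:: (0, hub_outcomes a w);
                    (0, [:: (a, false, true, w); (a, true, true, w)])] else [::];
      if d && (a || (w0 != w)) then [:: (1, [:: (false, a || b, true, w0)])]
      else [::]].

Definition final (s : state) :=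
  let: (a, b, _, w) := s in [&& ~~ a, ~~ b & all id w].

(** Storing a table as data lets each round of the iteration compute an entry once. [Leaf 0] serves
    as the zero table, since [lookup] ignores the bits left at a leaf. *)
Inductive trie := Leaf of nat | Node of trie & trie.

Fixpoint tabulate m (g : bitseq -> nat) : trie :=
  if m is m'.+1 then
    Node (tabulate m' (fun l => g (false :: l))) (tabulate m' (fun l => g (true :: l)))
  else Leaf (g [::]).

Fixpoint lookup (t : trie) (l : bitseq) : nat :=
  match t, l with
  | Leaf k, _ => k
  | Node t0 t1, b :: l' => lookup (if b then t1 else t0) l'
  | _, _ => 0
  end.

Definition value (T : trie) (b : bool) (s : state) : nat :=
  let: (a, c, d, w) := s in lookup T [:: b, a, c, d & w].

(* Nothing is proved about the tables computed here: [verified] checks them. *)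
Definition step opts T b (s : state) : nat :=
  if final s then 0 else
  let l := [seq m.1 + value T (~~ b) (head s m.2) | m <- moves opts s] in
  if b then foldr minn (head 0 l) l else foldr maxn 0 l.

Definition iterate n opts paired T :=
  tabulate n.+4 (fun l =>
    if l is [:: b, a, c, d & w] then
      if paired || ~~ [|| a, c | d] then step opts T b (a, c, d, w) else 0
    else 0).

Definition values n opts paired k := iter k (iterate n opts paired) (Leaf 0).

(** The state does not determine which outcome of a move occurs, so the bound for every move and the
    move attaining it are both required for all outcomes. *)
Definition bellman opts T (s : state) b :=
  if final s then value T b s == 0 else
  all (fun m => all (fun o => prefers b (value T b s) (m.1 + value T (~~ b) o)) m.2)
      (moves opts s)
  && has (fun m => all (fun o => prefers b (m.1 + value T (~~ b) o) (value T b s)) m.2)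
         (moves opts s).

Fixpoint words m : seq bitseq :=
  if m is m'.+1 then
    let w := words m' in [seq false :: l | l <- w] ++ [seq true :: l | l <- w]
  else [:: [::]].

(* [p] tells which core vertices are present.  Without pairs ([paired] false), only
   the states whose first three bits are false occur. *)
Definition verified n (p : pred nat) opts paired T :=
  all (fun l => if l is [:: b, a, c, d & w] then
         [==> paired || ~~ [|| a, c | d], all (fun x => p x || nth true w x) (iota 0 n)
            => bellman opts T (a, c, d, w) b]
       else true)
      (words n.+4).

Definition start n (p : pred nat) paired : state :=
  (paired, false, false, mkseq (fun x => ~~ p x) n).


Definition edge (E : seq (nat * nat)) x y :=
  (x != y) && (((x, y) \in E) || ((y, x) \in E)).


(** * Bit sequences *)

Lemma merge_map (I : Type) (f g : I -> bool) (r : seq I) :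
  merge_bits (map f r) (map g r) = [seq f x || g x | x <- r].
Proof. by rewrite /merge_bits; elim: r => //= x r ->. Qed.

Lemma merge_map_neq (I : Type) (f g : I -> bool) (r : seq I) :
  (merge_bits (map f r) (map g r) != map f r) = has (fun x => ~~ f x && g x) r.
Proof.
rewrite merge_map; elim: r => //= x r IH; rewrite eqseq_cons negb_and IH.
by case: (f x); case: (g x).
Qed.

Lemma play_hub_map n (f : 'I_n -> bool) :
  play_hub (map f (enum 'I_n)) = [seq f x || (x == 0 :> nat) | x <- enum 'I_n].
Proof.
case: n f => [|n] f; first by rewrite !enum_ord0.
rewrite enum_ordSl /= orbT; congr (_ :: _); rewrite -!map_comp.
by apply: eq_map => x /=; rewrite orbF.
Qed.

Lemma mem_words w : w \in words (size w).
Proof.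
elim: w => //= b w IH; rewrite mem_cat.
by case: b; rewrite map_f ?orbT.
Qed.

(** * The graphs with pairs and the abstraction of their positions *)

Section PairGraph.
Variables (n q : nat) (E : seq (nat * nat)).

(* [inr (i, false)] is the i-th hub and [inr (i, true)] the i-th leaf. *)
Definition pair_vertex := ('I_n + 'I_q * bool)%type.

Definition pair_adj (u v : pair_vertex) : bool :=
  match u, v with
  | inl x, inl y => edge E x y
  | inl x, inr (_, t) => (x == 0 :> nat) && ~~ t
  | inr (_, t), inl x => (x == 0 :> nat) && ~~ t
  | inr (i, s), inr (j, t) => if i == j then s != t else ~~ s && ~~ t
  end.

Fact pair_adj_sym : symmetric pair_adj.
Proof.
move=> [x|[i s]] [y|[j t]] //=; first by rewrite /edge eq_sym orbC.
by rewrite [j == i]eq_sym; case: eqP => _; [rewrite eq_sym | rewrite andbC].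
Qed.

Fact pair_adj_irr : irreflexive pair_adj.
Proof. by move=> [x|[i s]] /=; rewrite /edge ?eqxx. Qed.

Definition pair_graph := SGraph pair_adj_sym pair_adj_irr.

Variable p : pred nat.

Definition present (u : pair_vertex) := if u is inl x then p x else true.
Definition hub i : pair_vertex := inr (i, false).
Definition leaf i : pair_vertex := inr (i, true).
Definition dominates u v := (v == u) || pair_adj u v.

Implicit Types h : pair_vertex -> bool.

Definition update h u v := h v || dominates u v.
Definition consistent h :=
  (forall i, h (leaf i) -> h (hub i)) /\ (forall u, ~~ present u -> h u).
Definition legal_move h u := [exists v, ~~ h v && dominates u v].

Definition bits h := [seq h (inl x) | x <- enum 'I_n].
Definition abs h : state :=
  ([exists i, ~~ h (hub i)], [exists i, h (hub i) && ~~ h (leaf i)],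
   [exists i, h (leaf i)], bits h).
Definition remaining h := \sum_i ~~ h (leaf i).

Lemma eq_abs h h' : h =1 h' -> abs h = abs h'.
Proof.
move=> e; rewrite /abs /bits; congr (_, _, _, _); last by apply: eq_map => x.
all: by apply: eq_existsb => i; rewrite ?e.
Qed.

Lemma dominates_pair i s j t :
  dominates (inr (i, s)) (inr (j, t)) = (i == j) || ~~ s && ~~ t.
Proof.
rewrite /dominates /= (inj_eq (@inr_inj _ _)) xpair_eqE [j == i]eq_sym.
by case: eqP => _ //; case: s; case: t.
Qed.

(** Only a leaf and its hub dominate the leaf, and both also dominate the hub. *)
Lemma consistent_update h u : consistent h -> consistent (update h u).
Proof.
move=> [h1 h2]; split=> [i|v /h2]; rewrite /update; last by move->.
case/orP=> [/h1->//|zu]; apply/orP; right; move: zu.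
case: u => [x|[j t]]; first by rewrite /dominates /= andbF.
by rewrite !dominates_pair andbF orbF => ->.
Qed.

(** Gives the second bit after a move that dominates all hubs but no new leaf. *)
Lemma exists_undominated h : consistent h ->
  [exists i, ~~ h (leaf i)] =
  [exists i, ~~ h (hub i)] || [exists i, h (hub i) && ~~ h (leaf i)].
Proof.
move=> [hl _]; apply/existsP/orP => [[i zi]|[]/existsP[i]].
- by case E1: (h (hub i)); [right|left]; apply/existsP; exists i; rewrite E1.
- by move=> ci; exists i; apply: contra ci => /hl.
- by case/andP=> _; exists i.
Qed.

Lemma bits_update_core h (x : 'I_n) :
  bits (update h (inl x)) =
  merge_bits (bits h) (mkseq (fun y => (y == x) || edge E x y) n).
Proof.
rewrite /mkseq -val_enum_ord -map_comp merge_map; apply: eq_map => y /=.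
by rewrite /update /dominates.
Qed.

Lemma bits_update_hub h i : bits (update h (hub i)) = play_hub (bits h).
Proof.
rewrite play_hub_map; apply: eq_map => x.
by rewrite /update /dominates /= andbT.
Qed.

Lemma bits_update_leaf h i : bits (update h (leaf i)) = bits h.
Proof. by apply: eq_map => x; rewrite /update /dominates /= ?andbF ?orbF. Qed.


(** * Effect and legality of moves *)

Lemma abs_update_core h (x : 'I_n) : consistent h ->
  abs (update h (inl x)) =
  let: (a, b, d, _) := abs h in
  if x == 0 :> nat then (false, a || b, d, bits (update h (inl x)))
  else (a, b, d, bits (update h (inl x))).
Proof.
move=> hC; have Ec i s : update h (inl x) (inr (i, s)) =
    h (inr (i, s)) || (x == 0 :> nat) && ~~ s by [].
rewrite /abs; case: eqP Ec => _ Ec; congr (_, _, _, _).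
- by apply/existsP => -[i]; rewrite Ec /= orbT.
- rewrite -exists_undominated //; apply: eq_existsb => i.
  by rewrite !Ec /= orbT orbF.
all: by apply: eq_existsb => i; rewrite !Ec ?orbF.
Qed.

Lemma abs_update_hub h i :
  abs (update h (hub i)) =
  (false, [exists j, (j != i) && ~~ h (leaf j)], true, play_hub (bits h)).
Proof.
have Ec j s : update h (hub i) (inr (j, s)) = [|| h (inr (j, s)), i == j | ~~ s].
  by rewrite /update dominates_pair.
rewrite -(bits_update_hub _ i); congr (_, _, _, _).
- by apply/existsP => -[j]; rewrite Ec /= !orbT.
- by apply: eq_existsb => j; rewrite !Ec /= !orbT orbF negb_or /= andbC [i == j]eq_sym.
- by apply/existsP; exists i; rewrite Ec eqxx orbT.
Qed.

Lemma abs_update_leaf h i :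
  abs (update h (leaf i)) =
  ([exists j, (j != i) && ~~ h (hub j)],
   [exists j, [&& j != i, h (hub j) & ~~ h (leaf j)]], true, bits h).
Proof.
have Ec j s : update h (leaf i) (inr (j, s)) = h (inr (j, s)) || (i == j).
  by rewrite /update dominates_pair orbF.
rewrite -(bits_update_leaf _ i); congr (_, _, _, _).
- by apply: eq_existsb => j; rewrite Ec negb_or andbC [i == j]eq_sym.
- apply: eq_existsb => j; rewrite !Ec negb_or [i == j]eq_sym.
  by case: eqP; rewrite ?orbT ?orbF ?andbF ?andbT.
- by apply/existsP; exists i; rewrite Ec eqxx orbT.
Qed.

Lemma remaining_core h x : remaining (update h (inl x)) = remaining h.
Proof. by apply: eq_bigr => i _; rewrite /update /dominates /= andbF orbF. Qed.

(** Both vertices of a pair dominate its own leaf and no other leaf. *)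
Lemma remaining_pair h i s :
  remaining h = ~~ h (leaf i) + remaining (update h (inr (i, s))).
Proof.
rewrite /remaining (bigD1 i) //=; congr (_ + _).
rewrite [RHS](bigD1 i) //= {1}/update dominates_pair eqxx orbT /=.
apply: eq_bigr => j ne; rewrite /update dominates_pair [i == j]eq_sym (negPf ne).
by rewrite /= andbF orbF.
Qed.

Definition core_moves :=
  [seq (x == 0, mkseq (fun y => (y == x) || edge E x y) n) | x <- iota 0 n & p x].

(** The equation says, without subtraction, that one move dominates [1 - m.1] new leaves. *)
Definition realizes h u (m : nat * seq state) :=
  abs (update h u) \in m.2 /\ remaining h + m.1 = (remaining (update h u)).+1.

Lemma legal_core h (x : 'I_n) : consistent h ->
  legal_move h (inl x) =
  (bits (update h (inl x)) != bits h) || (x == 0 :> nat) && [exists i, ~~ h (hub i)].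
Proof.
move=> [hl _]; rewrite bits_update_core /mkseq -val_enum_ord -map_comp merge_map_neq.
apply/existsP/orP => [[[y|[i s]]]|[/hasP[y _]|/andP[x0 /existsP[i ci]]]].
- by move=> yx; left; apply/hasP; exists y; rewrite ?mem_enum.
- rewrite /dominates /= => /and3P[ci -> s0]; right; apply/existsP; exists i.
  by move: s0 ci; case: s.
- by exists (inl y).
- by exists (hub i); rewrite ci /dominates /= x0.
Qed.

Lemma legal_hub h i : consistent h ->
  legal_move h (hub i) =
  [|| ~~ h (leaf i), [exists j, ~~ h (hub j)] | play_hub (bits h) != bits h].
Proof.
move=> [hl _]; rewrite /bits play_hub_map.
have -> : ([seq h (inl x) || (x == 0 :> nat) | x <- enum 'I_n] !=
    [seq h (inl x) | x <- enum 'I_n]) = [exists x : 'I_n, ~~ h (inl x) && (x == 0 :> nat)].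
  rewrite -merge_map merge_map_neq; apply/hasP/existsP => -[x]; first by exists x.
  by exists x; rewrite ?mem_enum.
apply/existsP/or3P => [[[x|[j s]]]|[zi|/existsP[j cj]|/existsP[x xP]]].
- by move=> xP; constructor 3; apply/existsP; exists x; rewrite /dominates /= andbT in xP.
- rewrite dominates_pair; case: s => /=; last first.
    by case/andP=> cj _; constructor 2; apply/existsP; exists j.
  by rewrite orbF => /andP[zj /eqP e]; constructor 1; rewrite e.
- by exists (leaf i); rewrite dominates_pair eqxx zi.
- by exists (hub j); rewrite dominates_pair cj orbT.
- by exists (inl x); rewrite /dominates /= andbT.
Qed.

(** Besides itself a leaf dominates only its hub, and by consistency the leaf is undominated
    whenever the hub is. *)
Lemma legal_leaf h i : consistent h -> legal_move h (leaf i) = ~~ h (leaf i).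
Proof.
move=> [hl _]; apply/existsP/idP => [[[x|[j s]]]|zi].
- by rewrite /dominates /= andbF andbF.
- rewrite dominates_pair /= orbF => /andP[zj /eqP e]; move: zj; rewrite -e.
  by case: s => //; apply: contra => /hl.
- by exists (leaf i); rewrite zi dominates_pair eqxx.
Qed.

(** * Correspondence between moves in the graph and abstract moves *)

Section Realize.
Variables (h : pair_vertex -> bool) (hC : consistent h).
Let a := [exists i, ~~ h (hub i)].
Let b := [exists i, h (hub i) && ~~ h (leaf i)].
Let d := [exists i, h (leaf i)].
Let w := bits h.

Lemma mem_hub_outcomes (c c' : bool) v :
  (c -> c') -> (false, c', true, play_hub v) \in hub_outcomes c v.
Proof. by rewrite /hub_outcomes; case: c c' => [] [] H; rewrite ?(H isT) !inE eqxx ?orbT. Qed.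

Lemma realizes_core (x : 'I_n) :
  realizes h (inl x)
    (1, [:: if x == 0 :> nat then (false, a || b, d, bits (update h (inl x)))
            else (a, b, d, bits (update h (inl x)))]).
Proof.
by split; rewrite ?remaining_core ?addn1 //= mem_seq1 abs_update_core.
Qed.

Lemma realizes_fresh_hub i : ~~ h (hub i) -> realizes h (hub i) (0, hub_outcomes b w).
Proof.
move=> ci; have zi : ~~ h (leaf i) by case: hC => hl _; apply: contra ci => /hl.
split; last by rewrite addn0 (remaining_pair _ i false) zi.
rewrite abs_update_hub mem_hub_outcomes // => /existsP[j /andP[cj zj]].
by apply/existsP; exists j; rewrite zj andbT; apply: contraNneq ci => <-.
Qed.

Lemma realizes_half_hub i : h (hub i) -> ~~ h (leaf i) ->
  realizes h (hub i) (0, hub_outcomes a w).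
Proof.
move=> ci zi; split; last by rewrite addn0 (remaining_pair _ i false) zi.
rewrite abs_update_hub mem_hub_outcomes // => /existsP[j cj].
apply/existsP; exists j; rewrite (contraNneq _ cj) => [|->//] /=.
by case: hC => hl _; apply: contra cj => /hl.
Qed.

Lemma realizes_closed_hub i : h (leaf i) ->
  realizes h (hub i) (1, [:: (false, a || b, true, play_hub w)]).
Proof.
move=> zi; split; last by rewrite addn1 [in LHS](remaining_pair _ i false) zi.
rewrite abs_update_hub mem_seq1 /a /b -exists_undominated //; apply/eqP.
congr (_, _, _, _); apply: eq_existsb => j.
by case: eqVneq => [->|] //=; rewrite zi.
Qed.

Lemma realizes_fresh_leaf i : ~~ h (hub i) ->
  realizes h (leaf i) (0, [:: (false, b, true, w); (true, b, true, w)]).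
Proof.
move=> ci; have zi : ~~ h (leaf i) by case: hC => hl _; apply: contra ci => /hl.
split; last by rewrite addn0 (remaining_pair _ i true) zi.
rewrite abs_update_leaf; have -> : [exists j, [&& j != i, h (hub j) & ~~ h (leaf j)]] = b.
  by apply: eq_existsb => j; case: eqVneq => [->|] //=; rewrite (negPf ci).
by rewrite !inE; case: [exists j, _ && _]; rewrite eqxx ?orbT.
Qed.

Lemma realizes_half_leaf i : h (hub i) -> ~~ h (leaf i) ->
  realizes h (leaf i) (0, [:: (a, false, true, w); (a, true, true, w)]).
Proof.
move=> ci zi; split; last by rewrite addn0 (remaining_pair _ i true) zi.
rewrite abs_update_leaf; have -> : [exists j, (j != i) && ~~ h (hub j)] = a.
  by apply: eq_existsb => j; case: eqVneq => [->|] //=; rewrite ci.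
by rewrite !inE; case: [exists j, [&& _, _ & _]]; rewrite eqxx ?orbT.
Qed.

(** A move in a pair is classified by which of its hub and leaf are already dominated. *)
Lemma move_sound u : present u -> legal_move h u ->
  exists2 m, m \in moves core_moves (abs h) & realizes h u m.
Proof.
rewrite /moves /= -/a -/b -/d -/w.
case: u => [x|[i [] _]].
- move=> /= px uL; eexists; last exact: realizes_core.
  rewrite mem_cat; apply/orP; left; apply/mapP.
  exists (x == 0 :> nat, mkseq (fun y => (y == x) || edge E x y) n) => /=; last first.
    by rewrite -bits_update_core.
  rewrite mem_filter /= -bits_update_core -legal_core // uL /=.
  apply/mapP; exists (val x) => //.
  by rewrite mem_filter mem_iota /= px ltn_ord.
- rewrite legal_leaf // => zi; case ci: (h (hub i)).
    exists (0, [:: (a, false, true, w); (a, true, true, w)]); last exact: realizes_half_leaf.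
    have -> : b by apply/existsP; exists i; rewrite ci.
    by rewrite !mem_cat !inE eqxx ?orbT.
  move/negbT: ci => ci.
  exists (0, [:: (false, b, true, w); (true, b, true, w)]); last exact: realizes_fresh_leaf.
  have -> : a by apply/existsP; exists i.
  by rewrite !mem_cat !inE eqxx ?orbT.
- rewrite legal_hub //; case zi: (h (leaf i)) => /=.
    move=> uL; eexists; last exact: realizes_closed_hub.
    have -> : d by apply/existsP; exists i.
    by rewrite uL !mem_cat !inE eqxx ?orbT.
  move/negbT: zi => zi _; case ci: (h (hub i)).
    exists (0, hub_outcomes a w); last exact: realizes_half_hub.
    have -> : b by apply/existsP; exists i; rewrite ci.
    by rewrite !mem_cat !inE eqxx ?orbT.
  move/negbT: ci => ci.
  exists (0, hub_outcomes b w); last exact: realizes_fresh_hub.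
  have -> : a by apply/existsP; exists i.
  by rewrite !mem_cat !inE eqxx ?orbT.
Qed.

(** For a move outside the core, the bit that enables it supplies the pair in which to play. *)
Lemma move_complete m : m \in moves core_moves (abs h) ->
  exists2 u, present u & legal_move h u /\ realizes h u m.
Proof.
rewrite /moves /= -/a -/b -/d -/w !mem_cat => /or4P[||| /orP[]//].
- case/mapP=> o; rewrite mem_filter => /andP[oL /mapP[x]].
  rewrite mem_filter mem_iota => /andP[px /= xn] eo ->.
  exists (inl (Ordinal xn)) => //; move: oL; rewrite eo /=.
  rewrite -(bits_update_core h (Ordinal xn)) => oL.
  split; first by rewrite legal_core.
  exact: realizes_core.
- case: ifP => // /existsP[i ci]; have zi : ~~ h (leaf i).
    by case: hC => hl _; apply: contra ci => /hl.
  rewrite !inE => /orP[] /eqP->.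
    by exists (hub i) => //; split; [rewrite legal_hub ?zi|apply: realizes_fresh_hub].
  by exists (leaf i) => //; split; [rewrite legal_leaf|apply: realizes_fresh_leaf].
- case: ifP => // /existsP[i /andP[ci zi]].
  rewrite !inE => /orP[] /eqP->.
    by exists (hub i) => //; split; [rewrite legal_hub ?zi|apply: realizes_half_hub].
  by exists (leaf i) => //; split; [rewrite legal_leaf|apply: realizes_half_leaf].
- case: ifP => // /andP[/existsP[i zi] L]; rewrite inE => /eqP->.
  by exists (hub i) => //; split; [rewrite legal_hub // L orbT|apply: realizes_closed_hub].
Qed.

End Realize.

(** * Game lengths for induced subgraphs of the pair graph *)

Section Embedding.
Variables (G : sgraph) (f : G -> pair_vertex) (T : trie).
Hypotheses (f_inj : injective f)
  (f_adj : forall x y, adj x y = pair_adj (f x) (f y))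
  (f_im : forall u, present u = (u \in codom f))
  (T_ok : verified n p core_moves (0 < q) T).
Implicit Types D : {set G}.

(* Deleted vertices count as dominated. *)
Definition dominated D u := ~~ present u || (u \in f @: D).

Lemma dominated_image D x : dominated D (f x) = (x \in D).
Proof. by rewrite /dominated f_im codom_f mem_imset. Qed.

Lemma dominated_absent D u : ~~ present u -> dominated D u.
Proof. by rewrite /dominated => ->. Qed.

Lemma dominates_image x y : dominates (f x) (f y) = (y \in cl_neigh x).
Proof. by rewrite inE /dominates f_adj (inj_eq f_inj). Qed.

Lemma dominated_update D x : dominated (D :|: cl_neigh x) =1 update (dominated D) (f x).
Proof.
move=> u; case pu: (present u); last by rewrite /update !dominated_absent ?pu.
move: pu; rewrite f_im => /codomP[y ->].
by rewrite /update !dominated_image dominates_image inE.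
Qed.

Lemma legalE D x : legal D x = legal_move (dominated D) (f x).
Proof.
apply/subsetPn/existsP => [[y yx yD]|[u /andP[uD ux]]].
  by exists (f y); rewrite dominated_image yD dominates_image.
case pu: (present u); last by rewrite dominated_absent ?pu in uD.
move: pu uD ux; rewrite f_im => /codomP[y ->].
by rewrite dominated_image dominates_image; exists y.
Qed.

Lemma finalE D : consistent (dominated D) -> final (abs (dominated D)) = (D == setT).
Proof.
move=> [hl hp]; apply/and3P/eqP => [[/existsPn a /existsPn b w]|->].
  apply/setP => x; rewrite inE -dominated_image.
  case: (f x) => [y|[i s]]; first by apply: (allP w); apply: map_f; rewrite mem_enum.
  have ci := a i; have := b i; rewrite !negbK in ci *.
  by rewrite ci /= negbK; case: s.
have all1 u : dominated setT u.
  case pu: (present u); last by rewrite dominated_absent ?pu.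
  by move: pu; rewrite f_im => /codomP[y ->]; rewrite dominated_image inE.
split; try by apply/existsPn => i; rewrite !all1.
by apply/allP => _ /mapP[x _ ->]; apply: all1.
Qed.

(** Consistent positions stay within the states checked by [verified]: absent core vertices have bit
    true, and for [q = 0] the three pair bits are false. *)
Lemma bellman_abs h b : consistent h -> bellman core_moves T (abs h) b.
Proof.
move=> [_ hp]; have lW : [:: b, [exists i, ~~ h (hub i)],
    [exists i, h (hub i) && ~~ h (leaf i)], [exists i, h (leaf i)] & bits h] \in words n.+4.
  have <- : size (bits h) = n by rewrite size_map size_enum_ord.
  exact: (mem_words [:: _, _, _, _ & bits h]).
have /implyP H := allP T_ok _ lW; apply: (implyP (H _)).
  case: posnP => //= q0; have noq (P : pred 'I_q) : [exists i, P i] = false.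
    by apply/existsP => -[i _]; have := leq_ltn_trans (leq0n i) (ltn_ord i); rewrite q0.
  by rewrite !noq.
apply/allP => x; rewrite mem_iota => /= xn.
rewrite (nth_map (Ordinal xn)) ?size_enum_ord // (nth_ord_enum _ (Ordinal xn)).
by case px: (p x) => //=; apply: hp; rewrite /= px.
Qed.

Lemma prefers_add2l b k m m' : prefers b (k + m) (k + m') = prefers b m m'.
Proof. by case: b; rewrite /= leq_add2l. Qed.

Theorem game_value b : game b (set0 : {set G}) = q + value T b (start n p (0 < q)).
Proof.
pose F c D := remaining (dominated D) + value T c (abs (dominated D)).
have inv0 : consistent (dominated set0).
  by split=> [i|u /dominated_absent//]; rewrite /dominated imset0 inE.
have -> : q + value T b (start n p (0 < q)) = F b set0.
  have h0 u : dominated set0 u = ~~ present u by rewrite /dominated imset0 inE orbF.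
  congr (_ + _).
    rewrite /remaining (eq_bigr (fun=> 1)) => [|i _]; last by rewrite h0.
    by rewrite sum1_card card_ord.
  congr value; rewrite /abs /start /bits; congr (_, _, _, _).
  - apply/idP/existsP => [q0|[i _]]; last exact: leq_ltn_trans (ltn_ord i).
    by exists (Ordinal q0); rewrite h0.
  - by apply/esym/existsP => -[i]; rewrite h0.
  - by apply/esym/existsP => -[i]; rewrite h0.
  - by rewrite /mkseq -val_enum_ord -map_comp; apply: eq_map => x; rewrite h0.
have Fupd c D x : F c (D :|: cl_neigh x) =
    remaining (update (dominated D) (f x)) + value T c (abs (update (dominated D) (f x))).
  rewrite /F (eq_abs (dominated_update D x)); congr (_ + _).
  by apply: eq_bigr => i _; rewrite dominated_update.
(* After this rewriting the remaining leaves cancel from the optimality equations, which leaves the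
   inequalities of [bellman]. *)
have Fstep c D x m : realizes (dominated D) (f x) m ->
    (F c (D :|: cl_neigh x)).+1 =
    remaining (dominated D) + (m.1 + value T c (abs (update (dominated D) (f x)))).
  by case=> _ e; rewrite Fupd addnA e addSn.
apply: (game_unique (inv := fun D => consistent (dominated D)) (F := F)) inv0.
- move=> D x hC; have [hl hp] := consistent_update (f x) hC.
  by split=> [i|u]; rewrite !dominated_update; [apply: hl|apply: hp].
- move=> c; have hC : consistent (dominated setT).
    split=> [i _|u /dominated_absent//].
    have : present (hub i) by [].
    rewrite f_im => /codomP[y ->].
    by rewrite dominated_image inE.
  have := bellman_abs c hC; rewrite /bellman finalE // eqxx => /eqP v0.
  rewrite /F v0 addn0; apply: big1 => i _.
  have : present (leaf i) by [].
  rewrite f_im => /codomP[y ->].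
  by rewrite dominated_image inE.
- move=> c D x hC xL; have DT : D != setT.
    by apply: contraTneq xL => ->; rewrite /legal subsetT.
  have [||m mM mR] := @move_sound (dominated D) hC (f x); rewrite -?legalE //.
    by rewrite f_im codom_f.
  have := bellman_abs c hC; rewrite /bellman finalE // (negPf DT) => /andP[/allP/(_ _ mM)].
  case: (mR) => oM _ /allP/(_ _ oM) le _.
  by rewrite (Fstep _ _ _ _ mR) prefers_add2l.
- move=> c D hC DT; have := bellman_abs c hC.
  rewrite /bellman finalE // (negPf DT) => /andP[_ /hasP[m mM /allP le]].
  have [u] := move_complete hC mM; rewrite f_im => /codomP[x ->] [xL mR].
  exists x; first by rewrite legalE.
  by rewrite (Fstep _ _ _ _ mR) prefers_add2l le //; case: mR.
Qed.

End Embedding.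

End PairGraph.

(** * Certificates by computation and connectedness *)

(** Along first outcomes, twice the first bit plus the second bit plus the number of undominated
    core vertices drops with every move. It is at most [n.+3], so that many rounds suffice. *)
Definition certified n E p paired b r :=
  let opts := core_moves n E p in
  let T := values n opts paired n.+3 in
  verified n p opts paired T && (value T b (start n p paired) == r).

Lemma game_pair_graph n q E b r : certified n E predT (0 < q) b r ->
  game b (set0 : {set pair_graph n q E}) = q + r.
Proof.
case/andP=> T_ok /eqP <-.
apply: (game_value (G := pair_graph n q E) (f := id) _ _ _ T_ok) => // u.
by rewrite (codom_f id u); case: u.
Qed.

Lemma game_del_vertex n q E v (vn : v < n) b r : certified n E (predC1 v) (0 < q) b r ->
  game b (set0 : {set @del_vertex (pair_graph n q E) (inl (Ordinal vn))}) = q + r.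
Proof.
case/andP=> T_ok /eqP <-.
apply: (game_value (G := @del_vertex (pair_graph n q E) _) (f := val) _ _ _ T_ok)
  => // [|u]; first exact: val_inj.
apply/idP/codomP => [pu|[[x xv] ->]]; last first.
  by case: x xv => //= x; apply: contraNN => /eqP xv; apply/eqP; congr inl; apply: val_inj.
have uv : u != inl (Ordinal vn).
  by apply: contraTneq pu => ->; rewrite /= eqxx.
by exists (exist _ u uv).
Qed.

(** Every core vertex but 0 has a neighbor of smaller number, so descending reaches 0; hubs are
    adjacent to 0 and leaves to hubs. *)
Lemma connected_pair_graph n q E :
  0 < n -> all (fun x => has (edge E x) (iota 0 x)) (iota 1 n.-1) ->
  connected (pair_graph n q E).
Proof.
case: n => // n _ /allP rooted x y.
have symG : connect_sym (@adj (pair_graph n.+1 q E)).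
  exact/sym_connect_sym/adj_sym.
suff root u : connect (@adj (pair_graph n.+1 q E)) u (inl ord0).
  by apply: connect_trans (root x) _; rewrite symG.
have core m (lt_m : m < n.+1) :
    connect (@adj (pair_graph n.+1 q E)) (inl (Ordinal lt_m)) (inl ord0).
  elim/ltn_ind: m lt_m => m IH lt_m; have [m0|m_gt0] := posnP m.
    by rewrite (_ : Ordinal lt_m = ord0) ?connect0 //; apply: val_inj.
  have : m \in iota 1 n by rewrite mem_iota m_gt0.
  move/rooted/hasP=> [k]; rewrite mem_iota => /= lt_k e_mk.
  apply: connect_trans (IH k lt_k (ltn_trans lt_k lt_m)).
  exact: connect1.
case: u => [[m lt_m]|[i s]]; first exact: core.
have hub0 : connect (@adj (pair_graph n.+1 q E)) (inr (i, false)) (inl ord0).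
  exact: connect1.
case: s => //; apply: connect_trans hub0; apply: connect1.
by rewrite /= eqxx.
Qed.

(** Deleting a core vertex keeps all [q] pairs, so [q] cancels in the difference and one pair of
    certificates serves all lengths. *)
Lemma realizable n q paired E v b r s t l :
  v < n -> all (fun x => has (edge E x) (iota 0 x)) (iota 1 n.-1) ->
  (0 < q) = paired -> q + r = l -> s + t = r ->
  certified n E predT paired b r && certified n E (predC1 v) paired b s ->
  exists (G : sgraph) (v : G), connected G /\ game b (set0 : {set G}) = l /\
    ((game b (set0 : {set G}))%:Z - (game b (set0 : {set del_vertex v}))%:Z = t%:Z)%R.
Proof.
move=> vn rooted <- <- <- /andP[rP sP].
exists (pair_graph n q E), (inl (Ordinal vn)).
rewrite (game_pair_graph rP) (game_del_vertex vn sP); split; last split=> //.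
  exact: connected_pair_graph (leq_ltn_trans (leq0n v) vn) rooted.
by rewrite addnA PoszD GRing.Theory.addrAC GRing.Theory.subrr GRing.Theory.add0r.
Qed.

(** * The cores and the choice of parameters *)

(** Vertex 0 is a cut vertex: its deletion splits the core into the edge 1-2 and a star with center
    4. *)
Definition spider := [:: (0, 1); (1, 2); (0, 3); (3, 4); (4, 5); (4, 6)].

(* Needed for l = 5 in Game 2, t = 2: there Staller can only force 5 moves by opening
   on v, which requires gamma_g (G - v) = 4 although gamma_g' (G - v) = 3. *)
Definition sporadic :=
  [:: (0, 1); (1, 2); (1, 3); (1, 4); (1, 5); (2, 6); (2, 7); (2, 8); (3, 6); (3, 9);
      (4, 6); (4, 7); (4, 9); (5, 7); (5, 8)].


Theorem mainTheorem4 (t l : nat) :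
  t \in [:: 0; 1; 2] -> 5 <= l ->
  (exists (G : sgraph) (v : G),
     connected G /\ gamma_g G = l /\
     ((gamma_g G)%:Z - (gamma_g (del_vertex v))%:Z = t%:Z)%R) /\
  (exists (G : sgraph) (v : G),
     connected G /\ gamma_g' G = l /\
     ((gamma_g' G)%:Z - (gamma_g' (del_vertex v))%:Z = t%:Z)%R).
Proof.
move=> t012 l5; have l0 : 0 < l by apply: leq_trans l5.
have q1 : 0 < l.-1 by rewrite -ltnS prednK // (leq_trans _ l5).
have e1 : l.-1 + 1 = l by rewrite addn1 prednK.
move: t012; rewrite !inE => /or3P[] /eqP->; split.
(* For [t] at most 1 the core is a single vertex or an edge. *)
- by apply: (@realizable 1 l true [::] 0 true 0 0 0 l isT isT l0 (addn0 l)); vm_compute.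
- by apply: (@realizable 2 _ true [:: (0, 1)] 1 false 1 1 0 l isT isT q1 e1); vm_compute.
- by apply: (@realizable 2 _ true [:: (0, 1)] 1 true 1 0 1 l isT isT q1 e1); vm_compute.
- by apply: (@realizable 1 _ true [::] 0 false 1 0 1 l isT isT q1 e1); vm_compute.
- have q4 : 0 < l - 4 by rewrite subn_gt0.
  by apply: (@realizable 7 _ true spider 0 true 4 2 2 l isT isT q4 (subnK (ltnW l5)));
    vm_compute.
(* The general core accounts for 5 moves and needs at least one pair, so [l = 5] gets a graph
   without pairs. *)
- move: l5; rewrite leq_eqVlt => /predU1P[<-|l6].
    by apply: (@realizable 10 0 false sporadic 0 false 5 3); vm_compute.
  have q5 : 0 < l - 5 by rewrite subn_gt0.
  by apply: (@realizable 8 _ true ((4, 7) :: spider) 0 false 5 3 2 l isT isT q5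
    (subnK (ltnW l6))); vm_compute.
Qed.
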